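(* Let $\mathbb{K}\in\{\mathbb{R},\mathbb{C}\}$ and let $f\in\mathbb{K}[x_1,\dots,x_n]$ be a homogeneous polynomial of degree $d$. Then $f$ is equivalent to some polynomial in $\mathcal{P}_d$ if and only if its slices $\{T_{i_1\dots i_{d-2}}\}_{i_1,\dots,i_{d-2}\in[n]}$ span a non-singular matrix space and are simultaneously diagonalisable by congruence, i.e., there exists an invertible $Q\in M_n(\mathbb{K})$ such that $Q^TT_{i_1\dots i_{d-2}}Q$ is diagonal for all $i_1,\dots,i_{d-2}\in[n]$.
   Context: The slices of $f$: let $(T_{i_1\dots i_d})$ be the unique symmetric tensor with $f=\sum_{i_1,\dots,i_d\in[n]}T_{i_1\dots i_d}x_{i_1}\cdots x_{i_d}$; the slice $T_{i_1\dots i_{d-2}}$ is the $n\times n$ matrix with $(i_{d-1},i_d)$ entry $T_{i_1\dots i_d}$. $\mathcal{P}_d$ is the set of polynomials $\sum_{i=1}^n\alpha_ix_i^d$ with all $\alpha_i\in\mathbb{K}\setminus\{0\}$. $f$ is equivalent to $g$ if $f(x)=g(Ax)$ for some invertible $A\in M_n(\mathbb{K})$. A subspace of matrices is non-singular if it contains at least one invertible matrix. *)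

(* Defs.v *)
From HB Require Import structures.
From mathcomp Require Import all_boot all_order all_fingroup all_algebra.
From mathcomp Require Import reals complex.
From mathcomp Require Import mpoly.

Set Implicit Arguments.
Unset Strict Implicit.
Unset Printing Implicit Defensive.

Import GRing.Theory.
Local Open Scope ring_scope.

Section Definitions.
Variables (K : fieldType) (n d : nat).
Implicit Types (f g : {mpoly K[n]}) (T : {ffun d.-tuple 'I_n -> K}).

Definition tensor_symmetric T : Prop :=
  forall (s : 'S_d) (t : d.-tuple 'I_n), T [tuple tnth t (s k) | k < d] = T t.

Definition tensor_form T : {mpoly K[n]} :=
  \sum_(t : d.-tuple 'I_n) T t *: \prod_(k < d) 'X_(tnth t k).

(* For f homogeneous of degree d and K of characteristic 0 there is exactly
   one such T: lemma sym_tensor_exists_unique below. *)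
Definition is_sym_tensor_of f T : Prop :=
  tensor_symmetric T /\ f = tensor_form T.

Definition slice (hd : (2 <= d)%N) T (s : (d - 2).-tuple 'I_n) : 'M[K]_n :=
  \matrix_(i, j) T (tcast (subnK hd) [tuple of s ++ [:: i; j]]).

Definition slice_space (hd : (2 <= d)%N) T : {vspace 'M[K]_n} :=
  <<[seq slice hd T s | s : (d - 2).-tuple 'I_n]>>%VS.

Definition nonsingular_space (V : {vspace 'M[K]_n}) : Prop :=
  exists2 M, M \in V & M \in unitmx.

Definition simdiag_by_congruence (I : Type) (M : I -> 'M[K]_n) : Prop :=
  exists2 Q : 'M[K]_n, Q \in unitmx & forall s, is_diag_mx (Q^T *m M s *m Q).

Definition linear_subst (A : 'M[K]_n) : n.-tuple {mpoly K[n]} :=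
  [tuple \sum_(j < n) A i j *: 'X_j | i < n].

Definition poly_equiv f g : Prop :=
  exists2 A : 'M[K]_n, A \in unitmx & f = g \mPo linear_subst A.

Definition diagonal_form g : Prop :=
  exists2 a : 'I_n -> K, (forall i, a i != 0) & g = \sum_(i < n) a i *: 'X_i ^+ d.

End Definitions.

Section SymTensor.
Variables (K : fieldType) (n d : nat).
Hypothesis charK : [pchar K] =i pred0.
Implicit Types (f : {mpoly K[n]}) (T : {ffun d.-tuple 'I_n -> K}).
Implicit Types (t u : d.-tuple 'I_n).

Let mon t : 'X_{1..n} := [multinom count_mem i t | i < n].

Let monE t : mon t = (\sum_(k < d) U_(tnth t k))%MM.
Proof.
apply/mnmP => i; rewrite mnm_sumE mnmE -sum1_count.
rewrite (big_tuple _ _ t (fun j => pred1 i j) (fun=> 1%N)) [LHS]big_mkcond /=.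
by apply: eq_bigr => k _; rewrite mnm1E; case: eqP.
Qed.

Let prod_mon t : \prod_(k < d) 'X_(tnth t k) = 'X_[mon t] :> {mpoly K[n]}.
Proof.
by rewrite monE (big_morph (@mpolyX n K) (@mpolyXD n K) (@mpolyX0 n K)).
Qed.

Let mon_eq t u : mon t = mon u -> exists s : 'S_d, u = [tuple tnth t (s k) | k < d].
Proof.
move=> e; have : perm_eq u t.
  apply/allP => i _ /=; apply/eqP.
  by move/mnmP/(_ i): e; rewrite !mnmE.
by case/tuple_permP => s e2; exists s; apply: val_inj.
Qed.

Let mon_perm t (s : 'S_d) : mon [tuple tnth t (s k) | k < d] = mon t.
Proof.
apply/mnmP => i; rewrite !mnmE; apply/seq.permP.
by apply/tuple_permP; exists s.
Qed.

Let mdeg_mon t : mdeg (mon t) = d.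
Proof.
by rewrite monE mdeg_sum (eq_bigr (fun=> 1%N)) ?sum1_card ?card_ord // => k _; rewrite mdeg1.
Qed.

Let mon_surj (m : 'X_{1..n}) : mdeg m = d -> exists t, mon t = m.
Proof.
move=> hm; pose s := flatten [seq nseq (m i) i | i <- enum 'I_n].
have cs i : count_mem i s = m i.
  rewrite count_flatten -map_comp sumnE big_map big_enum /=.
  rewrite (bigD1 i) //= count_nseq /= eqxx mul1n big1 ?addn0 // => j ji.
  by rewrite count_nseq /= (negPf ji).
have ss : size s == d.
  rewrite -hm mdegE size_flatten /shape -map_comp sumnE big_map big_enum /=.
  by apply/eqP/eq_bigr => i _; rewrite size_nseq.
by exists (Tuple ss); apply/mnmP => i; rewrite mnmE /= cs.
Qed.

Let cnt (m : 'X_{1..n}) : nat := #|[pred t | mon t == m]|.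

Let cnt_neq0 t : (cnt (mon t))%:R != 0 :> K.
Proof.
have : (0 < cnt (mon t))%N by apply/card_gt0P; exists t; rewrite inE eqxx.
by rewrite ((pcharf0P K).1 charK) lt0n.
Qed.

Let coef_form T m : (tensor_form T)@_m = \sum_(t | mon t == m) T t.
Proof.
rewrite /tensor_form raddf_sum /= [RHS]big_mkcond /=.
apply: eq_bigr => t _; rewrite mcoeffZ prod_mon mcoeffX.
by case: eqP => _; rewrite ?mulr1 ?mulr0.
Qed.

Let coef_sym T t : tensor_symmetric T ->
  (tensor_form T)@_(mon t) = T t * (cnt (mon t))%:R.
Proof.
move=> sT; rewrite coef_form mulr_natr -sumr_const.
apply: eq_bigr => u /eqP e.
by have [s ->] := mon_eq (esym e); apply: sT.
Qed.

Lemma sym_tensor_exists_unique f : f \is d.-homog ->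
  exists! T, is_sym_tensor_of f T.
Proof.
move=> /dhomogP hf.
exists [ffun t => f@_(mon t) / (cnt (mon t))%:R]; split.
  have sT : tensor_symmetric [ffun t => f@_(mon t) / (cnt (mon t))%:R].
    by move=> s t; rewrite !ffunE mon_perm.
  split=> //; apply/mpolyP => m.
  have [/mon_surj[t <-]|/eqP hm] := eqVneq (mdeg m) d.
    by rewrite coef_sym // ffunE divfK.
  rewrite coef_form big1 => [|t /eqP e]; last by case: hm; rewrite -e mdeg_mon.
  by apply/eqP; rewrite mcoeff_eq0; apply/negP => /hf.
move=> T [sT ->]; apply/ffunP => t.
by rewrite ffunE coef_sym // mulfK.
Qed.

End SymTensor.

(* Main.v *)
Require Import Defs.
From HB Require Import structures.
From mathcomp Require Import all_boot all_order all_fingroup all_algebra.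
From mathcomp Require Import reals complex.
From mathcomp Require Import mpoly.

Import GRing.Theory.
Local Open Scope ring_scope.

(** By uniqueness of the symmetric tensor, [f = g(Ax)] with
    [g = \sum_i a_i x_i^d] means exactly that
    [T_u = \sum_i a_i \prod_k A_(i, u_k)].  The slices of such a tensor are
    [A^T D_s A] with [D_s] diagonal with entries [a_i \prod_k A_(i, s_k)];
    combining them with the weights [\prod_k v_(s_k)], where [A v] is the
    all-one vector, produces the invertible matrix [A^T diag(a) A].
    Conversely, if [Q] diagonalises the slices by congruence, the tensor
    obtained from [T] by the change of basis [Q] vanishes whenever its last two
    indices differ, hence by symmetry off the diagonal; changing the basis back
    by [A = Q^-1] puts [T] in the above shape, and an invertible combination of
    slices forces every [a_i] to be nonzero. *)

(** * Tuple sums and products, split at the last two entries *)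

Section TupleSums.
Variables (R : comNzRingType) (n : nat).

Lemma prod_sum_tuple d (F : 'I_d -> 'I_n -> R) :
  \prod_(k < d) \sum_(j < n) F k j =
  \sum_(t : d.-tuple 'I_n) \prod_(k < d) F k (tnth t k).
Proof.
rewrite bigA_distr_bigA /=.
rewrite (reindex (fun t : d.-tuple 'I_n => [ffun k => tnth t k])) /=.
  by apply: eq_bigr => t _; apply: eq_bigr => k _; rewrite ffunE.
exists (fun g : {ffun 'I_d -> 'I_n} => [tuple g k | k < d]) => [t _|g _].
  by apply: eq_from_tnth => k; rewrite tnth_mktuple ffunE.
by apply/ffunP => k; rewrite ffunE tnth_mktuple.
Qed.

Lemma tuple_cat2E e (t : (e + 2).-tuple 'I_n) :
  [tuple of [tuple tnth t (lshift 2 k) | k < e] ++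
    [:: tnth t (rshift e ord0); tnth t (rshift e ord_max)]] = t.
Proof.
apply: eq_from_tnth => k.
rewrite -[k]splitK; case: (split k) => j /=.
  by rewrite tnth_lshift tnth_mktuple.
rewrite tnth_rshift.
by case: j => -[|[|//]] j; congr (tnth t (rshift e _)); apply: val_inj.
Qed.

(** Keeping [d] a variable, tied to [e + 2] by [h], lets the proof eliminate the cast and still
    covers [subnK hd], the cast inside [slice]. *)
Lemma sum_tuple_cat2 e d (h : (e + 2)%N = d) (F : d.-tuple 'I_n -> R) :
  \sum_(t : d.-tuple 'I_n) F t =
  \sum_(r : e.-tuple 'I_n) \sum_(i < n) \sum_(j < n)
    F (tcast h [tuple of r ++ [:: i; j]]).
Proof.
case: d / h F => F; under [RHS]eq_bigr do rewrite pair_big /=.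
rewrite pair_big /=.
rewrite (reindex (fun p : e.-tuple 'I_n * ('I_n * 'I_n) =>
  [tuple of p.1 ++ [:: p.2.1; p.2.2]])) //=.
exists (fun t : (e + 2).-tuple 'I_n => ([tuple tnth t (lshift 2 k) | k < e],
  (tnth t (rshift e ord0), tnth t (rshift e ord_max)))) => [[r [i j]] _|t _] /=.
  congr (_, (_, _)).
  - by apply: eq_from_tnth => k; rewrite tnth_mktuple tnth_lshift.
  - by rewrite tnth_rshift.
  - by rewrite tnth_rshift.
exact: tuple_cat2E.
Qed.

Lemma prod_tuple_cat2 e d (h : (e + 2)%N = d) (G : 'I_n -> 'I_n -> R)
    (r s : e.-tuple 'I_n) i j i' j' :
  \prod_(k < d) G (tnth (tcast h [tuple of r ++ [:: i; j]]) k)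
                  (tnth (tcast h [tuple of s ++ [:: i'; j']]) k) =
  (\prod_(k < e) G (tnth r k) (tnth s k)) * (G i i' * G j j').
Proof.
case: d / h; rewrite big_split_ord /=; congr (_ * _).
  by apply: eq_bigr => k _; rewrite !tnth_lshift.
by rewrite !big_ord_recl big_ord0 mulr1 !tnth_rshift.
Qed.

End TupleSums.

Lemma ex_perm2 {T : finType} (p q k l : T) :
  p != q -> k != l -> exists s : {perm T}, s p = k /\ s q = l.
Proof.
(* The left factor acts first and sends [p] to [k]; the right one moves the image of [q] to [l]. It
   fixes [k], which differs from [l] and, by injectivity, from the image of [q]. *)
move=> pq kl; exists (tperm p k * tperm (tperm p k q) l)%g.
rewrite !permM tpermL [tperm _ l (tperm p k q)]tpermL; split=> //.
by rewrite tpermD // 1?eq_sym // -[k in k != _](tpermL p k) (inj_eq perm_inj).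
Qed.

(** * Tensors under a change of basis *)

Section ChangeOfBasis.
Context {K : fieldType} {n d : nat}.
Implicit Types (T : {ffun d.-tuple 'I_n -> K}) (A Q : 'M[K]_n).

(** The multilinear form of [T] evaluated on columns of [Q]; for matrices this is the congruence by
    [Q]. *)
Definition tensor_base_change T Q : {ffun d.-tuple 'I_n -> K} :=
  [ffun t : d.-tuple 'I_n =>
    \sum_(u : d.-tuple 'I_n) T u * \prod_(k < d) Q (tnth u k) (tnth t k)].

Definition power_sum_tensor (a : 'I_n -> K) A : {ffun d.-tuple 'I_n -> K} :=
  [ffun t : d.-tuple 'I_n => \sum_(i < n) a i * \prod_(k < d) A i (tnth t k)].

Lemma tensor_base_changeM T Q A :
  tensor_base_change (tensor_base_change T Q) A = tensor_base_change T (Q *m A).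
Proof.
apply/ffunP => t; rewrite !ffunE.
under eq_bigr do rewrite ffunE mulr_suml.
rewrite exchange_big /=; apply: eq_bigr => u _.
under [X in _ = _ * X]eq_bigr do rewrite mxE.
rewrite prod_sum_tuple mulr_sumr; apply: eq_bigr => r _.
by rewrite -mulrA -big_split.
Qed.

Lemma tensor_base_change1 T : tensor_base_change T 1%:M = T.
Proof.
apply/ffunP => t; rewrite ffunE (bigD1 t) //= [X in _ * X + _]big1; last first.
  by move=> k _; rewrite mxE eqxx.
rewrite mulr1 big1 ?addr0 // => u ut.
have [k uk] : exists k, tnth u k != tnth t k.
  apply/existsP; apply: contraNT ut; rewrite negb_exists => /forallP e.
  by apply/eqP/eq_from_tnth => k; apply/eqP; have := e k; rewrite negbK.
by rewrite (bigD1 k) //= mxE (negPf uk) mul0r mulr0.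
Qed.

Lemma tensor_base_change_sym T Q :
  tensor_symmetric T -> tensor_symmetric (tensor_base_change T Q).
Proof.
move=> sT s t; rewrite !ffunE.
rewrite (reindex (fun u : d.-tuple 'I_n => [tuple tnth u (s k) | k < d])) /=.
  apply: eq_bigr => u _; rewrite sT; congr (_ * _).
  rewrite [RHS](reindex_perm s) /=.
  by apply: eq_bigr => k _; rewrite !tnth_mktuple.
exists (fun u : d.-tuple 'I_n => [tuple tnth u (s^-1%g k) | k < d]) => u _;
  by apply: eq_from_tnth => k; rewrite !tnth_mktuple ?permKV ?permK.
Qed.

(** The last two indices turn each slice into its congruence by [Q], the others only give weights.
    So if all these congruences are diagonal, entries with [i != j] vanish. *)
Lemma tensor_base_change_cat2 (hd : (2 <= d)%N) T Q
    (s : (d - 2).-tuple 'I_n) i j :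
  tensor_base_change T Q (tcast (subnK hd) [tuple of s ++ [:: i; j]]) =
  \sum_(r : (d - 2).-tuple 'I_n)
    (\prod_(k < d - 2) Q (tnth r k) (tnth s k)) *
    (Q^T *m slice hd T r *m Q) i j.
Proof.
rewrite ffunE (sum_tuple_cat2 _ _ _ _ (subnK hd)); apply: eq_bigr => r _.
rewrite mxE mulr_sumr exchange_big /=; apply: eq_bigr => l _.
rewrite mxE mulr_suml mulr_sumr; apply: eq_bigr => m _.
rewrite (prod_tuple_cat2 _ _ _ _ (subnK hd)) !mxE.
rewrite mulrCA !mulrA; congr (_ * _).
by rewrite -!mulrA; congr (_ * _); rewrite mulrC.
Qed.

Lemma sym_tensor_off_diagonal (hd : (2 <= d)%N) T : tensor_symmetric T ->
  (forall (s : (d - 2).-tuple 'I_n) i j, i != j ->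
     T (tcast (subnK hd) [tuple of s ++ [:: i; j]]) = 0) ->
  forall (t : d.-tuple 'I_n) k l, tnth t k != tnth t l -> T t = 0.
Proof.
move: (subnK hd); move: (d - 2)%N => e h; case: d / h T => T sT T0 t k l kl.
(* Permuting by [s] brings the two distinct entries of [t] to the last two positions. *)
have [||s [s0 s1]] := ex_perm2 (rshift e ord0) (rshift e (ord_max : 'I_2)) k l.
- by rewrite (inj_eq (@rshift_inj _ _)).
- by apply: contraNneq kl => ->.
rewrite -(sT s) -[mktuple _]tuple_cat2E; apply: T0.
by rewrite !tnth_mktuple s0 s1.
Qed.

Lemma diagonal_tensorE (d_gt0 : (0 < d)%N) T A :
  (forall (t : d.-tuple 'I_n) k l, tnth t k != tnth t l -> T t = 0) ->
  tensor_base_change T A = power_sum_tensor (fun i => T (nseq_tuple d i)) A.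
Proof.
move=> T0; apply/ffunP => u; rewrite !ffunE.
pose k0 := Ordinal d_gt0.
(* Tuples are grouped by their first entry [i]; in each group only the constant tuple
   contributes. *)
rewrite (partition_big (fun t : d.-tuple 'I_n => tnth t k0) predT) //=.
apply: eq_bigr => i _; rewrite (bigD1 (nseq_tuple d i)) /=; last first.
  by rewrite tnth_nseq.
rewrite [X in _ + X]big1 ?addr0 => [|t /andP[/eqP ti tn]].
  by congr (_ * _); apply: eq_bigr => k _; rewrite tnth_nseq.
have [k kt] : exists k, tnth t k != tnth t k0.
  apply/existsP; apply: contraNT tn; rewrite negb_exists => /forallP e.
  apply/eqP/eq_from_tnth => k; rewrite tnth_nseq -ti; apply/eqP.
  by have := e k; rewrite negbK.
by rewrite (T0 _ _ _ kt) mul0r.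
Qed.

(** * Tensors and slices of sums of powers of linear forms *)

Lemma power_sum_tensor_sym a A : tensor_symmetric (power_sum_tensor a A).
Proof.
move=> s t; rewrite !ffunE; apply: eq_bigr => i _; congr (_ * _).
rewrite [RHS](reindex_perm s) /=.
by apply: eq_bigr => k _; rewrite tnth_mktuple.
Qed.

Lemma power_sum_tensor_form a A :
  tensor_form (power_sum_tensor a A) =
  (\sum_(i < n) a i *: 'X_i ^+ d) \mPo linear_subst A.
Proof.
rewrite raddf_sum /= /tensor_form.
under [LHS]eq_bigr do rewrite ffunE scaler_suml.
rewrite exchange_big /=; apply: eq_bigr => i _.
rewrite linearZ /= rmorphXn /= comp_mpolyXU -tnth_nth tnth_mktuple.
rewrite -[d in _ ^+ d]card_ord -prodr_const prod_sum_tuple scaler_sumr.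
by apply: eq_bigr => t _; rewrite scaler_prod scalerA.
Qed.

Lemma power_sum_tensorP (charK : [pchar K] =i pred0) (f : {mpoly K[n]}) T a A :
  f \is d.-homog -> is_sym_tensor_of f T ->
  f = (\sum_(i < n) a i *: 'X_i ^+ d) \mPo linear_subst A <->
  T = power_sum_tensor a A.
Proof.
move=> hf hT; rewrite -power_sum_tensor_form; split=> [fE|TE].
  have [T' [_ uT]] := sym_tensor_exists_unique charK hf.
  rewrite -(uT _ hT); apply: uT; split=> //; exact: power_sum_tensor_sym.
by rewrite -TE; case: hT.
Qed.

Lemma slice_power_sum_tensor (hd : (2 <= d)%N) a A (s : (d - 2).-tuple 'I_n) :
  slice hd (power_sum_tensor a A) s =
  A^T *m diag_mx (\row_i (a i * \prod_(k < d - 2) A i (tnth s k))) *m A.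
Proof.
rewrite mul_mx_diag; apply/matrixP => p q; rewrite !mxE ffunE.
apply: eq_bigr => i _; rewrite !mxE.
(* The factor ignores its second argument, so the second copy of [s], [p], [q] is a dummy. *)
rewrite (prod_tuple_cat2 _ _ _ _ (subnK hd) (fun l _ => A i l) s s p q p q).
by rewrite !mulrA; congr (_ * _); rewrite mulrC mulrA.
Qed.

(** Matrices of this shape are closed under linear combinations. The factor [a i] stays explicit so
    that an invertible [M] forces it to be nonzero. *)
Lemma slice_space_power_sum_tensorP (hd : (2 <= d)%N) a A M :
  M \in slice_space hd (power_sum_tensor a A) ->
  exists c : 'I_n -> K, M = A^T *m diag_mx (\row_i (a i * c i)) *m A.
Proof.
move=> /coord_span ->.
elim/big_ind: _ => [|_ _ [c ->] [c' ->]|k _].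
- exists (fun=> 0); rewrite (_ : \row_i _ = 0) ?linear0 ?mulmx0 ?mul0mx //.
  by apply/rowP => i; rewrite !mxE mulr0.
- exists (fun i => c i + c' i); rewrite -mulmxDl -mulmxDr -linearD /=.
  by congr (_ *m diag_mx _ *m _); apply/rowP => i; rewrite !mxE mulrDr.
set x := coord _ _ _; rewrite -tnth_nth.
have /imageP[s _ ->] := mem_tnth k (image_tuple
  (slice hd (power_sum_tensor a A)) {: (d - 2).-tuple 'I_n}).
rewrite slice_power_sum_tensor.
exists (fun i => x * \prod_(k < d - 2) A i (tnth s k)).
rewrite scalemxAl scalemxAr -linearZ /=.
by congr (_ *m diag_mx _ *m _); apply/rowP => i; rewrite !mxE mulrCA.
Qed.

Lemma diag_in_slice_space (hd : (2 <= d)%N) a A : A \in unitmx ->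
  A^T *m diag_mx (\row_i a i) *m A \in slice_space hd (power_sum_tensor a A).
Proof.
move=> uA; pose v := invmx A *m const_mx 1 : 'cV[K]_n.
have Av i : \sum_j A i j * v j 0 = 1.
  have := congr1 (fun w : 'cV_n => w i 0) (mulKVmx uA (const_mx 1 : 'cV[K]_n)).
  by rewrite !mxE.
have -> : A^T *m diag_mx (\row_i a i) *m A =
    \sum_(s : (d - 2).-tuple 'I_n) (\prod_(k < d - 2) v (tnth s k) 0) *:
      slice hd (power_sum_tensor a A) s.
  under eq_bigr do rewrite slice_power_sum_tensor scalemxAl scalemxAr -linearZ /=.
  rewrite -mulmx_suml -mulmx_sumr -linear_sum /=.
  congr (_ *m diag_mx _ *m _); apply/rowP => i; rewrite summxE !mxE.
  (* Distributivity collects the weighted sum over [s] into a power of the [i]-th entry of [A v],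
     which is 1. *)
  transitivity (a i * \prod_(k < d - 2) \sum_j A i j * v j 0).
    by rewrite big1 ?mulr1 // => k _; rewrite Av.
  rewrite prod_sum_tuple mulr_sumr; apply: eq_bigr => s _.
  by rewrite !mxE big_split /= mulrA mulrC.
by apply: memv_suml => s _; apply/memvZ/memv_span/imageP; exists s.
Qed.

End ChangeOfBasis.

Lemma unit_congr_diag {K : fieldType} {n : nat} (A : 'M[K]_n) (b : 'rV_n) :
  A \in unitmx ->
  (A^T *m diag_mx b *m A \in unitmx) = [forall i, b 0 i != 0].
Proof.
move=> uA; rewrite !unitmx_mul unitmx_tr uA andbT /= unitmxE det_diag unitfE.
apply/idP/forallP => [/prodf_neq0 b0 i|b0]; first exact: b0.
by apply/prodf_neq0 => i _; exact: b0.
Qed.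

Theorem theorem3p5 (R : realType) (K : fieldType)
  (hK : K = (R : fieldType) \/ K = (R[i]%C : fieldType))
  (n d : nat) (hd : (2 <= d)%N)
  (f : {mpoly K[n]}) (hf : f \is d.-homog)
  (T : {ffun d.-tuple 'I_n -> K}) (hT : is_sym_tensor_of f T) :
  (exists2 g : {mpoly K[n]}, diagonal_form d g & poly_equiv f g) <->
  nonsingular_space (slice_space hd T) /\ simdiag_by_congruence (slice hd T).
Proof.
have charK : [pchar K] =i pred0 by case: hK => ->; exact: Num.Theory.pchar_num.
split=> [[_ [a a0 ->] [A uA fE]]|[[M MT uM] [Q uQ QT]]].
  have -> := (power_sum_tensorP charK _ _ a A hf hT).1 fE.
  split.
    exists (A^T *m diag_mx (\row_i a i) *m A); first exact: diag_in_slice_space.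
    by rewrite unit_congr_diag //; apply/forallP => i; rewrite mxE.
  exists (invmx A); rewrite ?unitmx_inv // => s.
  rewrite slice_power_sum_tensor !mulmxA -trmx_mul mulmxK // mulmxV //.
  by rewrite trmx1 mul1mx diag_mx_is_diag.
have [a TE] : exists a, T = power_sum_tensor a (invmx Q).
  (* The coefficients are the diagonal entries of the tensor in the basis given by [Q]; changing
     back by [invmx Q] recovers [T]. *)
  exists (fun i => tensor_base_change T Q (nseq_tuple d i)).
  rewrite -diagonal_tensorE ?(ltnW hd) //.
    by rewrite tensor_base_changeM mulmxV // tensor_base_change1.
  apply: (sym_tensor_off_diagonal hd).
    by apply: tensor_base_change_sym; case: hT.
  move=> s i j ij; rewrite tensor_base_change_cat2 big1 // => r _.
  by rewrite (is_diag_mxP (QT r)) ?mulr0.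
have uA : invmx Q \in unitmx by rewrite unitmx_inv.
exists (\sum_(i < n) a i *: 'X_i ^+ d); last first.
  exists (invmx Q) => //.
  exact: (power_sum_tensorP charK f T a (invmx Q) hf hT).2.
exists a => // i.
rewrite TE in MT; have [c ME] := slice_space_power_sum_tensorP _ _ _ _ MT.
move: uM; rewrite ME unit_congr_diag // => /forallP/(_ i).
by rewrite mxE mulf_eq0 negb_or => /andP[].
Qed.
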